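(* Let $q\ge 2$ be an integer such that there exists an affine plane of order $q$ or a projective plane of order $q$. Then there exist infinitely many co-edge-regular graphs $\Gamma$ such that $\Gamma$ has exactly four distinct eigenvalues, its smallest eigenvalue is $-2q-1$, and the number of common neighbours of adjacent vertex pairs takes at least $q+2$ distinct values, i.e. the set $\{|N_\Gamma(x)\cap N_\Gamma(y)| : x\sim y\}$ has at least $q+2$ elements. In particular, these graphs have coherent rank at least $q+4$.
   Context: Graphs are finite, simple and undirected, counted up to isomorphism; eigenvalues are those of the adjacency matrix; $N_\Gamma(x)$ is the set of neighbours of $x$. A graph is sesqui-regular with parameters $(v,k,\mu)$ if it has $v$ vertices, is $k$-regular, and every two non-adjacent vertices at distance two have exactly $\mu$ common neighbours. It is co-edge-regular with parameters $(v,k,\mu)$ if it is sesqui-regular with parameters $(v,k,\mu)$ and has diameter two (so every pair of distinct non-adjacent vertices has exactly $\mu$ common neighbours). The coherent closure $W(\Gamma)$ of a graph $\Gamma$ with adjacency matrix $A$ is the smallest matrix algebra over $\mathbb C$ containing $I$, the all-ones matrix $J$ and $A$ that is closed under transposition and entrywise multiplication. The coherent rank of $\Gamma$ is $\dim W(\Gamma)$. A partial linear space is a pair $(P,\mathcal L)$, where $P$ is a non-empty finite set of points and $\mathcal L$ is a set of subsets of $P$ (lines), such that every line contains at least two points and every two distinct points lie on at most one line. It is $(s,t)$-regular if every point is on $s+1$ lines and every line contains $t+1$ points. An affine plane of order $q$ is a $(q,q-1)$-regular partial linear space in which for every point $p$ and every line $L$ with $p\notin L$ there is a unique line through $p$ disjoint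 from $L$. A projective plane of order $q$ is a $(q,q)$-regular partial linear space in which any two distinct lines meet in exactly one point. *)

(* Defs.v *)
From HB Require Import structures.
From mathcomp Require Import all_boot all_order all_algebra.
From mathcomp Require Import boolp reals complex.

Set Implicit Arguments.
Unset Strict Implicit.
Unset Printing Implicit Defensive.

Import Order.TTheory GRing.Theory Num.Theory.
Local Open Scope ring_scope.

Record sgraph := SGraph {
  vertex :> finType;
  adj : rel vertex;
  adj_sym : symmetric adj;
  adj_irrefl : irreflexive adj
}.
Arguments adj {s} x y.

Definition graph_iso (G H : sgraph) : Prop :=
  exists f : G -> H, bijective f /\ (forall x y, adj (f x) (f y) = adj x y).

(* The isomorphism classes of graphs satisfying P form an infinite set. *)
Definition infinitely_many (P : sgraph -> Prop) : Prop :=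
  exists G : nat -> sgraph,
    (forall i, P (G i)) /\ (forall i j, i <> j -> ~ graph_iso (G i) (G j)).

Definition nbrs (G : sgraph) (x : G) : {set G} := [set y | adj x y].

Definition common_nbrs (G : sgraph) (x y : G) : nat := #|nbrs x :&: nbrs y|.

Definition walk (G : sgraph) (n : nat) (x y : G) : bool :=
  [exists p : n.-tuple G, path adj x p && (last x p == y)].

Definition at_distance (G : sgraph) (n : nat) (x y : G) : Prop :=
  walk n x y /\ (forall m, (m < n)%N -> ~~ walk m x y).

Definition has_diameter (G : sgraph) (d : nat) : Prop :=
  (forall x y : G, exists2 n, (n <= d)%N & at_distance n x y) /\
  (exists x y : G, at_distance d x y).

Definition sesqui_regular (G : sgraph) (v k mu : nat) : Prop :=
  [/\ #|G| = v,
      forall x : G, #|nbrs x| = k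
    & forall x y : G, ~~ adj x y -> at_distance 2 x y -> common_nbrs x y = mu].

Definition co_edge_regular (G : sgraph) (v k mu : nat) : Prop :=
  sesqui_regular G v k mu /\ has_diameter G 2.

Definition edge_common_nbrs (G : sgraph) : seq nat :=
  undup [seq common_nbrs p.1 p.2 | p <- enum {: G * G} & adj p.1 p.2].

Definition adjmx (F : fieldType) (G : sgraph) : 'M[F]_#|G| :=
  \matrix_(i, j) (adj (enum_val i) (enum_val j))%:R.

Definition num_distinct_eigenvalues (F : fieldType) (n : nat) (A : 'M[F]_n)
    (m : nat) : Prop :=
  exists s : seq F,
    [/\ uniq s, size s = m & forall a, eigenvalue A a = (a \in s)].

(* On R[i] the order a <= b means that b - a is a nonnegative real. *)
Definition smallest_eigenvalue (F : numFieldType) (n : nat) (A : 'M[F]_n)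
    (a : F) : Prop :=
  eigenvalue A a /\ (forall b, eigenvalue A b -> a <= b).

Definition coherent_algebra (F : fieldType) (n : nat)
    (W : {vspace 'M[F]_n}) : Prop :=
  [/\ 1%:M \in W,
      const_mx 1 \in W,
      forall M N, M \in W -> N \in W -> M *m N \in W,
      forall M, M \in W -> M^T \in W
    & forall M N, M \in W -> N \in W -> map2_mx *%R M N \in W].

Definition is_coherent_closure (F : fieldType) (n : nat) (A : 'M[F]_n)
    (W : {vspace 'M[F]_n}) : Prop :=
  [/\ coherent_algebra W, A \in W
    & forall U, coherent_algebra U -> A \in U -> (W <= U)%VS].

Lemma coherent_closure_exists (F : fieldType) (n : nat) (A : 'M[F]_n) :
  exists W, is_coherent_closure A W.
Proof.
pose P d := `[< exists W : {vspace 'M[F]_n},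
                  [/\ coherent_algebra W, A \in W & \dim W = d] >].
have exP : exists d, P d.
  exists (\dim {:'M[F]_n}); apply/asboolP; exists fullv.
  by split=> //; [split=> *|]; rewrite memvf.
case: (ex_minnP exP) => d /asboolP [W [cW AW dW]] min_d.
exists W; split=> // U cU AU.
have [W1 WJ WM WT Wh] := cW; have [U1 UJ UM UT Uh] := cU.
have cI : coherent_algebra (W :&: U)%VS.
  split; rewrite ?memv_cap ?W1 ?WJ //.
  - by move=> M N /memv_capP[MW MU] /memv_capP[NW NU]; rewrite memv_cap WM ?UM.
  - by move=> M /memv_capP[MW MU]; rewrite memv_cap WT ?UT.
  - by move=> M N /memv_capP[MW MU] /memv_capP[NW NU]; rewrite memv_cap Wh ?Uh.
have le_d : (\dim W <= \dim (W :&: U))%N.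
  rewrite dW; apply: min_d; apply/asboolP; exists (W :&: U)%VS.
  by split=> //; rewrite memv_cap AW.
have /eqP <- : (W :&: U)%VS == W by rewrite eqEdim capvSl.
exact: capvSr.
Qed.

Definition coherent_closure (F : fieldType) (n : nat) (A : 'M[F]_n) :
  {vspace 'M[F]_n} := projT1 (cid (coherent_closure_exists A)).

Lemma coherent_closureP (F : fieldType) (n : nat) (A : 'M[F]_n) :
  is_coherent_closure A (coherent_closure A).
Proof. exact: projT2 (cid (coherent_closure_exists A)). Qed.

Definition coherent_rank (R : realType) (G : sgraph) : nat :=
  \dim (coherent_closure (adjmx R[i] G)).

Definition partial_linear_space (P : finType) (L : {set {set P}}) : Prop :=
  [/\ (0 < #|P|)%N,
      forall l, l \in L -> (2 <= #|l|)%N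
    & forall x y : P, x != y ->
        (#|[set l in L | (x \in l) && (y \in l)]| <= 1)%N].

Definition pls_regular (P : finType) (L : {set {set P}}) (s t : nat) : Prop :=
  (forall p : P, #|[set l in L | p \in l]| = s.+1) /\
  (forall l, l \in L -> #|l| = t.+1).

Definition affine_plane (P : finType) (L : {set {set P}}) (q : nat) : Prop :=
  [/\ partial_linear_space L,
      pls_regular L q (q - 1)%N
    & forall (p : P) (l : {set P}), l \in L -> p \notin l ->
        exists! m : {set P}, [/\ m \in L, p \in m & [disjoint m & l]]].

Definition projective_plane (P : finType) (L : {set {set P}}) (q : nat) : Prop :=
  [/\ partial_linear_space L,
      pls_regular L q q
    & forall l m, l \in L -> m \in L -> l != m -> #|l :&: m| = 1%N].

(* Main.v *)
Require Import Defs.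
From mathcomp Require Import all_boot all_order all_algebra.
From mathcomp Require Import boolp reals complex.
From mathcomp Require Import all_fingroup ring zify.

Set Implicit Arguments.
Unset Strict Implicit.
Unset Printing Implicit Defensive.

Import Order.TTheory GRing.Theory Num.Theory.
Local Open Scope ring_scope.

(* An affine or projective plane of order q gives an orthogonal array f of
   q^2 words of length q+1 over q symbols in which any two coordinates take
   each pair of values exactly once; its powers are arrays g with n = q^k
   symbols, k arbitrary. Replace each word w of g by a block made of two copies
   of f, the symbols of the second copy being permuted by a permutation
   depending on w and on the coordinate. A vertex is then a word of length q+1
   over N = n q symbols, and any two coordinates take each pair of values
   exactly twice. Call two vertices adjacent when they are in the same block or
   agree in some coordinate. If K counts agreements and M is the restriction of
   K - J to the diagonal blocks, then A = K - I - M because words in different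
   blocks agree at most once, and the counting property gives
     K^2 = 2N K + 2q(q+1) J,  K M = 2q K,  M^2 = 2q M,
   whatever the permutations are. Hence the eigenvalues of A are 2N(q+1)-1-2q,
   2N-1-2q, -1 and -2q-1, non-adjacent vertices have 2q(q+1) common neighbours,
   and adjacent vertices of one block with a agreements have
   2(N-q)a + 2(q^2-1). Suitable permutations make a take all the values
   0, ..., q+1. *)

(** * Orthogonal arrays from planes *)

Definition orthogonal_array (I S U : finType) (f : U -> I -> S) : Prop :=
  forall i j s t, i != j ->
    #|[set u | (f u i == s) && (f u j == t)]| = 1%N.

(** For [i != j] the map sending [u] to [(f u i, f u j)] is a bijection onto [S * S]. *)
Lemma card_orthogonal_array (I S U : finType) (f : U -> I -> S) (i j : I) :
  i != j -> orthogonal_array f -> #|U| = (#|S| ^ 2)%N.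
Proof.
move=> ij fa; rewrite -mulnn -card_prod -!sum1_card.
rewrite (partition_big (fun u => (f u i, f u j)) predT) //=.
apply: eq_bigr => -[s t] _; rewrite sum1_card -[RHS](fa i j s t ij).
by apply: eq_card => u; rewrite [RHS]inE; apply: xpair_eqE.
Qed.

Definition pair_array (I S S' U U' : finType) (f : U -> I -> S)
    (f' : U' -> I -> S') (u : U * U') (i : I) : S * S' :=
  (f u.1 i, f' u.2 i).

Lemma pair_orthogonal_array (I S S' U U' : finType) (f : U -> I -> S)
    (f' : U' -> I -> S') :
  orthogonal_array f -> orthogonal_array f' ->
  orthogonal_array (pair_array f f').
Proof.
move=> af af' i j [s s'] [t t'] ij.
pose A := [set u | (f u i == s) && (f u j == t)].
pose A' := [set u | (f' u i == s') && (f' u j == t')].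
rewrite (_ : [set u | _] = setX A A'); first by rewrite cardsX af ?af'.
by apply/setP=> -[u u']; rewrite !inE /pair_array /= !xpair_eqE /= andbACA.
Qed.

(** Iterated product with [f] itself. The exponent starts at 1, so for [q >= 2] the alphabet has
    more than one symbol. *)
Lemma orthogonal_array_power (q k : nat) (I S U : finType) (f : U -> I -> S) :
  orthogonal_array f -> #|S| = q ->
  exists (T W : finType) (g : W -> I -> T),
    orthogonal_array g /\ #|T| = (q ^ k.+1)%N.
Proof.
move=> af Sq; elim: k => [|k [T [W [g [ag Tq]]]]].
  by exists S, U, f; rewrite expn1.
exists (S * T)%type, (U * W)%type, (pair_array f g).
by split; [exact: pair_orthogonal_array | rewrite card_prod Sq Tq -expnS].
Qed.

Lemma cards1_intro (T : finType) (A : {set T}) :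
  (exists2 x, x \in A & forall y, y \in A -> y = x) -> #|A| = 1%N.
Proof.
case=> x xA uA; apply/eqP/cards1P; exists x; apply/setP=> y; rewrite inE.
by apply/idP/eqP=> [/uA|->].
Qed.

(* Coordinates may take their values in unrelated sets (the lines of one
   parallel class); numbering the values of each coordinate turns such a
   family of mutually orthogonal partitions into an array over ['I_q]. *)
Lemma orthogonal_array_of_partitions (q : nat) (I S U : finType)
    (f : U -> I -> S) (u0 : U) :
  (0 < q)%N -> #|I| = q.+1 ->
  (forall i j x y, i != j ->
     exists2 z, (f z i = f x i /\ f z j = f y j) &
       forall z', f z' i = f x i -> f z' j = f y j -> z' = z) ->
  (forall i, #|[set z | f z i == f u0 i]| = q) ->
  exists h : U -> 'I_q.+1 -> 'I_q, orthogonal_array h.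
Proof.
(* From here [q] is the order minus one, so that [inord] can number classes by ['I_q.+1]. *)
case: q => // q _ Iq cross lineq.
pose B i := [set f z i | z in U].
have fB z i : f z i \in B i by apply: imset_f.
(* A class of another coordinate [j] meets every class of [i] in exactly one point, so [i] has as
   many classes as that one has points. *)
have Bq i : #|B i| = q.+1.
  have [j ji] : exists j, j != i.
    have /card_gt1P[a [b [_ _ ab]]] : (1 < #|I|)%N by rewrite Iq.
    case: (eqVneq a i) => [<-|ai]; last by exists a.
    by exists b; rewrite eq_sym.
  rewrite -(lineq j).
  have -> : B i = [set f z i | z in [set z | f z j == f u0 j]].
    apply/setP=> s; apply/imsetP/imsetP=> -[z]; last by exists z.
    have [z' [z'j z'i] _] := cross j i u0 z ji.
    by move=> _ ->; exists z' => //; rewrite inE z'j.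
  rewrite card_in_imset // => x y; rewrite !inE => /eqP xj /eqP yj xy.
  have [z _ uz] := cross j i x y ji.
  by rewrite (uz x) // (uz y) // yj xj.
pose e (k : 'I_q.+2) : I := enum_val (cast_ord (esym Iq) k).
have eI : injective e by move=> a b /enum_val_inj /cast_ord_inj.
pose h z k : 'I_q.+1 := inord (index (f z (e k)) (enum (B (e k)))).
have hE z z' k : (h z k == h z' k) = (f z (e k) == f z' (e k)).
  apply/eqP/eqP=> [|zz']; last by rewrite /h zz'.
  move/(congr1 (@nat_of_ord _)); rewrite /h !inordK; last 2 first.
  - by rewrite -(Bq (e k)) cardE index_mem mem_enum.
  - by rewrite -(Bq (e k)) cardE index_mem mem_enum.
  move=> /(congr1 (nth (f z (e k)) (enum (B (e k))))).
  by rewrite !nth_index ?mem_enum.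
have hS k s : exists z, h z k = s.
  have sB : (s < size (enum (B (e k))))%N by rewrite -cardE Bq.
  have := mem_nth (f u0 (e k)) sB; rewrite mem_enum => /imsetP[z _ zs].
  by exists z; rewrite /h -zs index_uniq ?enum_uniq // inord_val.
exists h => i j s t ij; apply: cards1_intro.
have [x <-] := hS i s; have [y <-] := hS j t.
have eij : e i != e j by rewrite (inj_eq eI).
have [z [zi zj] uz] := cross _ _ x y eij.
exists z; first by rewrite inE !hE zi zj !eqxx.
by move=> z'; rewrite inE !hE => /andP[/eqP ? /eqP ?]; apply: uz.
Qed.

(** * Parallel classes of affine and projective planes *)

Section Planes.
Variables (P : finType) (L : {set {set P}}).

Lemma line_eq (l m : {set P}) (x y : P) : partial_linear_space L ->
  l \in L -> m \in L -> x != y ->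
  x \in l -> y \in l -> x \in m -> y \in m -> l = m.
Proof.
move=> [_ _ lin] lL mL xy xl yl xm ym.
have /card_le1_eqP := lin x y xy; apply; rewrite inE ?lL ?mL ?xl ?xm /= //.
Qed.

(** Words are points, and coordinates are the [q.+1] lines through a base point [p0], one for each
    parallel class; the value of [u] at [l] is the parallel to [l] through [u]. Lines of different
    classes meet in exactly one point. *)
Lemma array_of_affine_plane (q : nat) : (2 <= q)%N -> affine_plane L q ->
  exists (U : finType) (h : U -> 'I_q.+1 -> 'I_q), orthogonal_array h.
Proof.
move=> q2 [pls [deg size_line] playfair]; have [/card_gt0P[p0 _] _ _] := pls.
pose par (l m : {set P}) := (m == l) || [disjoint m & l].
have meet_disj (m l : {set P}) x : x \in m -> x \in l -> [disjoint m & l] = false.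
  by move=> xm xl; apply/negbTE/pred0Pn; exists x => /=; rewrite xm.
have exists_par l x : l \in L -> exists m, [&& m \in L, x \in m & par l m].
  move=> lL; have [xl|xl] := boolP (x \in l).
    by exists l; rewrite lL xl /par eqxx.
  have [m [[mL xm ml] _]] := playfair _ _ lL xl.
  by exists m; rewrite mL xm /par ml orbT.
(* This is transitivity of parallelism, from the uniqueness in Playfair's axiom. *)
have uniq_par l m m' x : l \in L -> m \in L -> m' \in L -> par l m -> par l m' ->
    x \in m -> x \in m' -> m = m'.
  move=> lL mL m'L lm lm' xm xm'; case/orP: lm => [/eqP ml|lm].
    by case/orP: lm' => [/eqP ->|]; rewrite // (meet_disj _ _ x) // -ml.
  case/orP: lm' => [/eqP m'l|lm'].
    by move: lm; rewrite (meet_disj _ _ x) // -m'l.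
  have xl : x \notin l.
    by apply/negP=> xl; move: lm; rewrite (meet_disj _ _ x).
  have [n [_ un]] := playfair _ _ lL xl.
  by rewrite -(un m) // -(un m').
pose Is := [set l in L | p0 \in l].
have Isq : #|{: {l | l \in Is}}| = q.+1 by rewrite card_sig -(deg p0).
pose f (u : P) (l : {l | l \in Is}) : {set P} :=
  odflt set0 [pick m | [&& m \in L, u \in m & par (val l) m]].
have IsP (l : {l | l \in Is}) : val l \in L /\ p0 \in val l.
  by have := valP l; rewrite inE => /andP[].
have fP u l : [/\ f u l \in L, u \in f u l & par (val l) (f u l)].
  rewrite /f; case: pickP => [m /and3P[]//|none].
  by have [m] := exists_par _ u (IsP l).1; rewrite none.
have fE u (l : {l | l \in Is}) m :
    m \in L -> u \in m -> par (val l) m -> f u l = m.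
  move=> mL um lm; have [? uf ?] := fP u l.
  exact: (uniq_par (val l) _ _ u (IsP l).1).
have line_f z x l : (f z l == f x l) = (z \in f x l).
  have [fL xf lf] := fP x l; have [_ zf _] := fP z l.
  by apply/eqP/idP=> [<- //|zx]; apply: fE.
have par_sym (l m : {set P}) : par l m = par m l.
  by rewrite /par eq_sym disjoint_sym.
(* Otherwise [i] and [j] would both be the parallel to [m] through [p0]. *)
have not_par2 (i j : {l | l \in Is}) m :
    m \in L -> i != j -> par (val i) m -> ~~ par (val j) m.
  move=> mL ij im; apply/negP=> jm; case/negP: ij; apply/eqP/val_inj.
  have [iL ip] := IsP i; have [jL jp] := IsP j.
  by apply: (uniq_par m _ _ p0) => //; rewrite par_sym.
apply: (ex_intro _ P).
apply: (@orthogonal_array_of_partitions q _ _ _ f p0) => //.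
- exact: leq_trans q2.
- move=> i j x y ij; set m := f x i; set m' := f y j.
  have [mL xm im] : [/\ m \in L, x \in m & par (val i) m] := fP x i.
  have [m'L ym' jm'] : [/\ m' \in L, y \in m' & par (val j) m'] := fP y j.
  have mm' : m != m'.
    apply: contraTN jm' => /eqP <-; exact: not_par2 im.
  (* If [m] and [m'] were disjoint, a common point of [m'] and a different line [val i] would carry
     two parallels to [m]; so [m'] would lie in the classes of both [i] and [j]. *)
  have [disj|/pred0Pn[z /= /andP[zm zm']]] := boolP [disjoint m & m'].
    suff im' : par (val i) m' by case/negP: (not_par2 _ _ _ m'L ij im').
    rewrite /par; have [//|m'i /=] := eqVneq m' (val i).
    case/orP: im => [/eqP <-|im]; first by rewrite disjoint_sym.
    apply/pred0P=> z /=; apply/negbTE/negP=> /andP[zm' zi].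
    case/negP: m'i; apply/eqP.
    apply: (uniq_par m _ _ z) => //; rewrite ?(IsP i).1 //.
    + by rewrite /par disjoint_sym disj orbT.
    + by rewrite /par disjoint_sym im orbT.
  exists z; first by split; apply/eqP; rewrite line_f.
  move=> z' /eqP z'i /eqP z'j; rewrite !line_f in z'i z'j.
  apply/eqP; apply: contraNT mm' => zz'; apply/eqP.
  exact: (line_eq pls mL m'L zz').
- move=> i; have [fL _ _] := fP p0 i.
  transitivity #|f p0 i|; first by apply: eq_card => z; rewrite inE line_f.
  by rewrite (size_line _ fL) subn1 prednK // (leq_trans _ q2).
Qed.

(** Removing a line [l0] leaves an affine plane: words are the points off [l0], coordinates the
    points at infinity on [l0], and the value of [u] at [p] is the line joining them. *)
Lemma array_of_projective_plane (q : nat) : (2 <= q)%N -> projective_plane L q ->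
  exists (U : finType) (h : U -> 'I_q.+1 -> 'I_q), orthogonal_array h.
Proof.
move=> q2 [pls [deg size_line] meet1]; have [/card_gt0P[p0 _] _ _] := pls.
have /card_gt0P[l0] : (0 < #|[set l in L | p0 \in l]|)%N by rewrite deg.
rewrite inE => /andP[l0L _].
(* Joining lines come from a count: the [q.+1] lines through [x] meet [l0] in distinct points, and
   [l0] has only [q.+1] points. *)
have join x p : x \notin l0 -> p \in l0 ->
    exists m, [&& m \in L, x \in m & p \in m].
  move=> xl0 pl0; pose X := [set l in L | x \in l].
  pose pt (l : {set P}) := odflt p0 [pick z in l :&: l0].
  have ptP l : l \in X -> pt l \in l :&: l0.
    rewrite inE => /andP[lL xl]; rewrite /pt; case: pickP => // none.
    have ll0 : l != l0 by apply: contraNneq xl0 => <-.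
    by have := meet1 _ _ lL l0L ll0; rewrite (eq_card0 none).
  have ptI : {in X &, injective pt}.
    move=> l m lX mX lm; have := ptP _ lX; have := ptP _ mX; rewrite -lm.
    move: lX mX; rewrite !inE => /andP[lL xl] /andP[mL xm].
    move=> /andP[zm zl0] /andP[zl _].
    have xz : x != pt l by apply: contraNneq xl0 => ->.
    exact: (line_eq pls lL mL xz).
  have : pt @: X == l0.
    rewrite eqEcard card_in_imset // (deg x) (size_line _ l0L) leqnn andbT.
    by apply/subsetP=> z /imsetP[l lX ->]; have := ptP _ lX; rewrite inE => /andP[].
  move/eqP=> eX; move: pl0; rewrite -eX => /imsetP[l lX pE].
  have := ptP _ lX; rewrite -pE inE => /andP[pl _].
  by move: lX; rewrite inE => /andP[lL xl]; exists l; rewrite lL xl pl.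
pose U := {x | x \notin l0}; pose I := {p | p \in l0}.
pose f (u : U) (p : I) : {set P} :=
  odflt set0 [pick m | [&& m \in L, val u \in m & val p \in m]].
have fP u p : [/\ f u p \in L, val u \in f u p & val p \in f u p].
  rewrite /f; case: pickP => [m /and3P[]//|none].
  by have [m] := join _ _ (valP u) (valP p); rewrite none.
have neqUI (u : U) (p : I) : val u != val p.
  by apply: contraNneq (valP u) => ->; apply: valP.
have line_f z x p : (f z p == f x p) = (val z \in f x p).
  have [fL xf pf] := fP x p; have [zL zf pzf] := fP z p.
  by apply/eqP/idP=> [<- //|zx]; apply: (line_eq pls zL fL (neqUI z p)).
have not_l0 x p : f x p != l0.
  by have [_ xf _] := fP x p; apply: contraNneq (valP x) => e; rewrite e in xf.
have meet_l0 x p z : z \in f x p -> z \in l0 -> z = val p.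
  move=> zf zl0; have [fL xf pf] := fP x p.
  apply/eqP; apply: contraNT (not_l0 x p) => zp; apply/eqP.
  exact: (line_eq pls fL l0L zp zf pf zl0 (valP p)).
(* Otherwise a second line would lie inside [l0] and meet it in [q.+1] points. *)
have [u0] : exists u0, u0 \notin l0.
  have [l lL ll0] : exists2 l, l \in L & l != l0.
    have /card_gt1P[a [b [aX bX ab]]] : (1 < #|[set l in L | p0 \in l]|)%N.
      by rewrite deg ltnS ltnW.
    move: aX bX; rewrite !inE => /andP[aL _] /andP[bL _].
    case: (eqVneq a l0) => [al0|]; last by exists a.
    by exists b; rewrite // eq_sym -al0.
  apply/existsP; rewrite -negb_forall; apply/negP=> /forallP all0.
  have := meet1 _ _ lL l0L ll0; rewrite (_ : l :&: l0 = l) ?size_line //.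
    by case: (q) q2.
  by apply/setIidPl/subsetP=> z _; apply: all0.
move=> u0l0; exists U.
apply: (@orthogonal_array_of_partitions q _ _ _ f (exist _ u0 u0l0)) => //.
- exact: leq_trans q2.
- by rewrite card_sig size_line.
- move=> i j x y ij.
  have [mL xm im] := fP x i; have [m'L ym' jm'] := fP y j.
  have mm' : f x i != f y j.
    apply: contraNneq ij => e; apply/eqP/val_inj.
    by apply: (@meet_l0 y j) (valP i); rewrite -e.
  have /eqP/cards1P[z zE] := meet1 _ _ mL m'L mm'.
  have : z \in f x i :&: f y j by rewrite zE inE.
  rewrite inE => /andP[zm zm'].
  have zl0 : z \notin l0.
    apply: contraNN ij => zl0; apply/eqP/val_inj.
    by rewrite -(meet_l0 _ _ _ zm zl0) (meet_l0 _ _ _ zm' zl0).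
  exists (exist _ z zl0); first by split; apply/eqP; rewrite line_f.
  move=> z' /eqP z'i /eqP z'j; rewrite !line_f in z'i z'j.
  by apply/val_inj/set1P; rewrite -zE inE z'i.
- move=> i; set x := exist _ _ _; have [fL xf pf] := fP x i.
  (* The class is a line without its one point at infinity. *)
  transitivity #|f x i :\ val i|; last first.
    by apply/eqP; rewrite -eqSS -(size_line _ fL) (cardsD1 (val i) (f x i)) pf.
  rewrite -(card_imset _ val_inj); apply: eq_card => z.
  apply/imsetP/setD1P=> [[u]|[zi zf]].
    by rewrite inE line_f => uf ->; split=> //; apply: neqUI.
  have zl0 : z \notin l0 by apply: contraNN zi => /(meet_l0 _ _ _ zf)->.
  by exists (exist _ z zl0); rewrite // inE line_f.
Qed.
End Planes.

(** * Spectra and coherent closures of adjacency matrices *)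

Section VertexMatrix.
Variables (F : fieldType) (V : finType).
Implicit Types h : V -> V -> F.

(** Entries are given by vertices rather than by their numbers, so that matrix products become sums
    over [V]. *)
Definition vertex_mx h : 'M[F]_#|V| :=
  \matrix_(i, j) h (enum_val i) (enum_val j).

Lemma vertex_mxE h x y : vertex_mx h (enum_rank x) (enum_rank y) = h x y.
Proof. by rewrite mxE !enum_rankK. Qed.

Lemma mulmx_vertex h h' :
  vertex_mx h *m vertex_mx h' = vertex_mx (fun x y => \sum_z h x z * h' z y).
Proof.
apply/matrixP=> i j; rewrite !mxE [RHS]big_enum_val /=.
by apply: eq_bigr => k _; rewrite !mxE.
Qed.

Lemma mulmx_vertexE h h' x y :
  (vertex_mx h *m vertex_mx h') (enum_rank x) (enum_rank y)
    = \sum_z h x z * h' z y.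
Proof. by rewrite mulmx_vertex vertex_mxE. Qed.

End VertexMatrix.

Section Spectrum.
Variables (F : fieldType) (n : nat) (A : 'M[F]_n).
Hypothesis symA : A^T = A.

(** If [v] is a row eigenvector for [a], then [(a - p.1) *: (v *m p.2) = 0] for every [p]; were [a]
    not listed, every [v *m p.2], and so their sum [v], would vanish. Conversely a nonzero column of
    [p.2], transposed by symmetry of [A], is an eigenvector. *)
Lemma eigenvalue_of_decomposition (s : seq (F * 'M[F]_n)) a :
  1%:M = \sum_(p <- s) p.2 ->
  (forall p, p \in s -> A *m p.2 = p.1 *: p.2) ->
  (forall p, p \in s -> p.2 != 0) ->
  eigenvalue A a = (a \in [seq p.1 | p <- s]).
Proof.
move=> s1 sA s0; apply/idP/mapP=> [/eigenvalueP[v vA v0]|[p ps ->]]; last first.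
  have /matrix0Pn[i [j Pij]] := s0 p ps.
  apply/eigenvalueP; exists (row j p.2^T).
    by rewrite -row_mul -{1}symA -trmx_mul sA // !linearZ.
  by apply/matrix0Pn; exists 0, i; rewrite !mxE.
suff /hasP[p ps /eqP ->] : has (fun p => a == p.1) s by exists p.
apply: contraNT v0 => /hasPn as0.
rewrite -[v]mulmx1 s1 mulmx_sumr big1_seq // => p /= ps.
have : (a - p.1) *: (v *m p.2) == 0.
  by rewrite scalerBl [p.1 *: _]scalemxAr -(sA p ps) mulmxA vA -scalemxAl subrr.
by rewrite scaler_eq0 subr_eq0 (negbTE (as0 p ps)) /= => /eqP.
Qed.

End Spectrum.

Section CoherentDimension.
Variables (F : fieldType) (n : nat) (W : {vspace 'M[F]_n}).
Hypothesis cohW : coherent_algebra W.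

Lemma coherent_power (T : 'M[F]_n) k :
  T \in W -> map_mx (fun x => x ^+ k) T \in W.
Proof.
have [_ WJ _ _ Wh] := cohW => TW; elim: k => [|k IH].
  by rewrite (_ : map_mx _ T = const_mx 1) //; apply/matrixP=> i j; rewrite !mxE.
rewrite (_ : map_mx _ T = map2_mx *%R T (map_mx (fun x => x ^+ k) T)) ?Wh //.
by apply/matrixP=> i j; rewrite !mxE exprS.
Qed.

(* A dependence between entrywise powers of T is a polynomial vanishing at
   every entry of T. *)
Lemma dim_coherent_entries (T : 'M[F]_n) (s : seq F) :
  T \in W -> uniq s -> (forall c, c \in s -> exists i j, T i j = c) ->
  (size s <= \dim W)%N.
Proof.
move=> TW us Ts.
pose X := [tuple map_mx (fun x => x ^+ k) T | k < size s].
suff fX : free X.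
  have /eqP <- : \dim <<X>> == size s by rewrite -{2}(size_tuple X).
  apply/dimvS/span_subvP=> M /tnthP[k ->]; rewrite tnth_mktuple.
  exact: coherent_power.
apply/freeP=> k kX0 i.
pose p := \poly_(j < size s) (if insub j is Some j' then k j' else 0).
have pE x : p.[x] = \sum_j k j * x ^+ j.
  rewrite horner_poly; apply: eq_bigr => j _.
  by rewrite insubT ?ltn_ord //= => jlt; congr (k _ * _); apply: val_inj.
suff p0 : p = 0.
  have := congr1 (fun r : {poly F} => r`_i) p0.
  rewrite coef_poly ltn_ord coef0 insubT ?ltn_ord //= => ilt <-.
  by congr k; apply: val_inj.
apply/eqP; apply: contraT => p0.
have := max_poly_roots p0 _ us; rewrite ltnNge size_poly; apply.
apply/allP=> c /Ts[a [b <-]]; apply/eqP; rewrite pE.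
have := congr1 (fun M : 'M[F]_n => M a b) kX0.
rewrite summxE [RHS]mxE => sum0; rewrite -[RHS]sum0; apply: eq_bigr => j _.
by rewrite nth_mktuple !mxE.
Qed.
End CoherentDimension.

Section AdjacencyMatrix.
Variables (F : numFieldType) (G : sgraph).
Implicit Types x y : G.

Lemma adjmxE : adjmx F G = vertex_mx (fun x y : G => (adj x y)%:R).
Proof. by []. Qed.

Lemma tr_adjmx : (adjmx F G)^T = adjmx F G.
Proof. by apply/matrixP=> i j; rewrite !mxE adj_sym. Qed.

Lemma sqr_adjmx x y :
  (adjmx F G *m adjmx F G) (enum_rank x) (enum_rank y) = (common_nbrs x y)%:R.
Proof.
rewrite adjmxE mulmx_vertexE /common_nbrs -sum1_card natr_sum [RHS]big_mkcond /=.
apply: eq_bigr => z _; rewrite !inE (adj_sym z) -natrM mulnb.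
by case: (_ && _).
Qed.

(** One matrix separates everything: the entrywise product of A and A^2, plus I, minus 2(J - A),
    shows the common neighbour counts on edges, -1 on the diagonal and -2 on non-edges. Negative
    values cannot collide with counts. *)
Lemma coherent_rank_lower_bound (W : {vspace 'M[F]_#|G|}) :
  coherent_algebra W -> adjmx F G \in W ->
  (exists x y, x != y /\ ~~ adj x y) ->
  (size (edge_common_nbrs G) + 2 <= \dim W)%N.
Proof.
move=> cW AW [x0 [y0 [xy0 nxy0]]]; set A := adjmx F G in AW *.
have [W1 WJ WM _ Wh] := cW.
pose T (B C : 'M[F]_#|G|) := map2_mx *%R B C + 1%:M - 2 *: (const_mx 1 - B).
have TW : T A (A *m A) \in W.
  by rewrite /T memvB ?memvD ?memvZ ?memvB ?Wh ?WM.
have TE x y : T A (A *m A) (enum_rank x) (enum_rank y) =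
    if adj x y then (common_nbrs x y)%:R else if x == y then -1 else -2.
  have -> (B C : 'M[F]_#|G|) i j :
      T B C i j = B i j * C i j + (i == j)%:R - 2 * (1 - B i j).
    by rewrite /T !mxE.
  rewrite sqr_adjmx /A adjmxE vertex_mxE (inj_eq enum_rank_inj).
  have [->|_] := eqVneq x y; first by rewrite adj_irrefl /=; ring.
  by case: adj => /=; ring.
pose s : seq F := [:: -1, -2 & [seq m%:R | m <- edge_common_nbrs G]].
have sizes : size s = (size (edge_common_nbrs G) + 2)%N.
  by rewrite /= size_map addn2.
rewrite -sizes; apply: (dim_coherent_entries cW TW).
  have neg c : c < 0 -> c \notin [seq m%:R | m <- edge_common_nbrs G] :> bool.
    by move=> c0; apply/mapP=> -[m _ cm]; move: c0; rewrite cm (le_gtF (ler0n _ _)).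
  rewrite /s cons_uniq inE negb_or !cons_uniq !neg ?oppr_lt0 ?ltr0n //=.
  rewrite map_inj_uniq ?undup_uniq ?andbT; last exact: (mulrIn (oner_neq0 _)).
  by rewrite eqr_opp -[1]/(1%:R) eqr_nat.
move=> c; rewrite !inE => /or3P[/eqP ->|/eqP ->|].
- by exists (enum_rank x0), (enum_rank x0); rewrite TE adj_irrefl eqxx.
- by exists (enum_rank x0), (enum_rank y0); rewrite TE (negbTE nxy0) (negbTE xy0).
case/mapP=> m; rewrite mem_undup => /mapP[[x y]].
rewrite mem_filter /= => /andP[xy _] -> ->.
by exists (enum_rank x), (enum_rank y); rewrite TE xy.
Qed.
End AdjacencyMatrix.

(** * Graphs of twisted pairs of arrays *)

Section TwistedGraph.
Variables (q : nat) (T S W U : finType).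
Variables (g : W -> 'I_q.+1 -> T) (f : U -> 'I_q.+1 -> S).
Variable sigma : W -> 'I_q.+1 -> {perm S}.
Hypotheses (q_gt0 : (0 < q)%N) (Sq : #|S| = q).
Hypotheses (ga : orthogonal_array g) (fa : orthogonal_array f).

(** In [(w, (b, u))], [w] is the block, [b] the copy of [f] and [u] the word of that copy. Vertices
    are labels, not letter sequences: the two copies of a word stay distinct even where the
    permutations are trivial. *)
Definition word : finType := (W * (bool * U))%type.
Implicit Types x y z : word.
Implicit Types i j : 'I_q.+1.

Definition letter x i : T * S :=
  (g x.1 i, (if x.2.1 then sigma x.1 i else 1%g) (f x.2.2 i)).

Definition agree x y : nat := #|[set i | letter x i == letter y i]|.

Definition word_adj x y : bool :=
  (x != y) && ((x.1 == y.1) || (0 < agree x y)%N).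

Lemma agree_sym x y : agree x y = agree y x.
Proof. by apply: eq_card => i; rewrite !inE eq_sym. Qed.

Lemma agree_refl x : agree x x = q.+1.
Proof.
rewrite /agree (eq_card (B := predT)) ?card_ord // => i.
by rewrite !inE eqxx.
Qed.

Lemma word_adj_sym : symmetric word_adj.
Proof. by move=> x y; rewrite /word_adj eq_sym (eq_sym x.1) agree_sym. Qed.

Lemma word_adj_irrefl : irreflexive word_adj.
Proof. by move=> x; rewrite /word_adj eqxx. Qed.

Definition twisted_graph : sgraph := SGraph word_adj_sym word_adj_irrefl.

(** Two agreements would give two words of [g] equal in two coordinates, hence the same block. *)
Lemma agree_le1 x y : x.1 != y.1 -> (agree x y <= 1)%N.
Proof.
move=> xy; rewrite leqNgt; apply/negP=> /card_gt1P[i [j []]].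
rewrite !inE !xpair_eqE => /andP[/eqP gi _] /andP[/eqP gj _] ij.
case/negP: xy; apply/eqP.
have /eqP/cards1P[w wE] := ga (g x.1 i) (g x.1 j) ij.
have xw : x.1 \in [set w] by rewrite -wE inE !eqxx.
have yw : y.1 \in [set w] by rewrite -wE inE gi gj !eqxx.
by rewrite (set1P xw) (set1P yw).
Qed.

Section Counting.
Variable F : numFieldType.

Lemma sum_indicator (I : finType) (c : I) : \sum_t (c == t)%:R = 1 :> F.
Proof.
rewrite (bigD1 c) //= eqxx big1 ?addr0 // => t; rewrite eq_sym => tc.
by rewrite (negbTE tc).
Qed.

Lemma sum_fst_indicator (c : T) : \sum_(t : T * S) (c == t.1)%:R = q%:R :> F.
Proof.
rewrite -(pair_bigA _ (fun t1 (t2 : S) => (c == t1)%:R : F)) /=.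
under eq_bigr => t1 _ do rewrite sumr_const Sq -[_ *+ q]mulr_natr.
by rewrite -mulr_suml sum_indicator mul1r.
Qed.

Lemma array_sum (I S' U' : finType) (h : U' -> I -> S') (i j : I) s t :
  orthogonal_array h -> i != j ->
  \sum_u (h u i == s)%:R * (h u j == t)%:R = 1 :> F.
Proof.
move=> ha ij; rewrite -[RHS](_ : #|[set u | (h u i == s) && (h u j == t)]|%:R = _).
  rewrite -sum1_card natr_sum [RHS]big_mkcond; apply: eq_bigr => u _.
  by rewrite inE -natrM mulnb; case: (_ && _).
by rewrite ha.
Qed.

Let other i : exists j, i != j.
Proof.
have /card_gt1P[a [b [_ _ ab]]] : (1 < #|'I_q.+1|)%N by rewrite card_ord.
by case: (eqVneq i a) => [->|ia]; [exists b | exists a].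
Qed.

Let N : F := #|T|%:R * q%:R.

(** Here the permutations drop out: they only relabel the symbols of [f], so each of the two copies
    still contains exactly one word with a prescribed pair. The component from [g] is constant on
    the block. *)
Lemma block_pair w i j s t : i != j ->
  \sum_(z | z.1 == w) (letter z i == s)%:R * (letter z j == t)%:R
    = 2 * ((g w i == s.1)%:R * (g w j == t.1)%:R) :> F.
Proof.
move=> ij; case: s t => [s1 s2] [t1 t2] /=.
rewrite (reindex_onto (fun p => (w, p)) snd) /=; last by case=> ? ? /= /eqP ->.
under eq_bigl => p do rewrite !eqxx.
rewrite -(pair_bigA _ (fun b u => (letter (w, (b, u)) i == (s1, s2))%:R *
   (letter (w, (b, u)) j == (t1, t2))%:R)) /=.
transitivity (\sum_(b : bool) ((g w i == s1)%:R * (g w j == t1)%:R : F)).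
  apply: eq_bigr => b _; pose p k := if b then sigma w k else 1%g.
  transitivity ((g w i == s1)%:R * (g w j == t1)%:R *
      (\sum_u (f u i == (p i)^-1%g s2)%:R * (f u j == (p j)^-1%g t2)%:R) : F).
    rewrite mulr_sumr; apply: eq_bigr => u _.
    rewrite /letter !xpair_eqE /= -/(p i) -/(p j).
    by rewrite !(can2_eq (permK _) (permKV _)) -!mulnb !natrM; ring.
  by rewrite (array_sum _ _ fa ij) mulr1.
by rewrite big_bool /=; ring.
Qed.

(** Sums [block_pair] over the letter at a second coordinate. *)
Lemma block_single w i s :
  \sum_(z | z.1 == w) (letter z i == s)%:R = 2 * q%:R * (g w i == s.1)%:R :> F.
Proof.
have [j ij] := other i.
transitivity (\sum_t \sum_(z | z.1 == w)
    (letter z i == s)%:R * (letter z j == t)%:R : F).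
  rewrite exchange_big /=; apply: eq_bigr => z _.
  by rewrite -mulr_sumr sum_indicator mulr1.
under eq_bigr => t _ do rewrite block_pair //.
by rewrite -mulr_sumr -mulr_sumr sum_fst_indicator; ring.
Qed.

Lemma block_size w : \sum_(z : word | z.1 == w) 1 = 2 * q%:R ^+ 2 :> F.
Proof.
pose i : 'I_q.+1 := ord0.
transitivity (\sum_s \sum_(z | z.1 == w) (letter z i == s)%:R : F).
  by rewrite exchange_big /=; apply: eq_bigr => z _; rewrite sum_indicator.
under eq_bigr => t _ do rewrite block_single.
by rewrite -mulr_sumr sum_fst_indicator; ring.
Qed.

(** Exactly one block has the prescribed pair of components from [g], and it contributes 2. *)
Lemma word_pair i j s t : i != j ->
  \sum_z (letter z i == s)%:R * (letter z j == t)%:R = 2 :> F.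
Proof.
move=> ij; rewrite (partition_big (fun z : word => z.1) predT) //=.
under eq_bigr => w _ do rewrite block_pair //.
by rewrite -mulr_sumr array_sum // mulr1.
Qed.

Lemma word_single i s : \sum_z (letter z i == s)%:R = 2 * N :> F.
Proof.
have [j ij] := other i.
transitivity (\sum_t \sum_z (letter z i == s)%:R * (letter z j == t)%:R : F).
  rewrite exchange_big /=; apply: eq_bigr => z _.
  by rewrite -mulr_sumr sum_indicator mulr1.
under eq_bigr => t _ do rewrite word_pair //.
by rewrite sumr_const card_prod Sq -[LHS]mulr_natr natrM.
Qed.

Lemma word_size : #|word|%:R = 2 * N ^+ 2 :> F.
Proof.
pose i : 'I_q.+1 := ord0.
transitivity (\sum_s \sum_z (letter z i == s)%:R : F).
  rewrite exchange_big /= -sum1_card natr_sum.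
  by apply: eq_bigr => z _; rewrite sum_indicator.
under eq_bigr => t _ do rewrite word_single.
by rewrite sumr_const card_prod Sq -[LHS]mulr_natr natrM -/N; ring.
Qed.

Definition agreement x y : F := (agree x y)%:R.

Definition twist x y : F := (x.1 == y.1)%:R * (agreement x y - 1).

Lemma agreementE x y : agreement x y = \sum_i (letter x i == letter y i)%:R.
Proof.
rewrite /agreement /agree -sum1_card natr_sum big_mkcond /=.
by apply: eq_bigr => i _; rewrite inE; case: (_ == _).
Qed.

Lemma agreement_sym x y : agreement x y = agreement y x.
Proof. by rewrite /agreement agree_sym. Qed.

Lemma twist_sym x y : twist x y = twist y x.
Proof. by rewrite /twist agreement_sym eq_sym. Qed.

(** Across blocks the number of agreements is 0 or 1 and is itself the adjacency; inside a block,
    subtracting the twist leaves 1 off the diagonal. *)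
Lemma twisted_adjE x y :
  (word_adj x y)%:R = agreement x y - (x == y)%:R - twist x y.
Proof.
rewrite /word_adj /twist /agreement; have [->|xy] /= := eqVneq x y.
  by rewrite agree_refl eqxx mul1r; ring.
have [_|w] /= := eqVneq x.1 y.1; first by rewrite mul1r; ring.
by have := agree_le1 w; case: agree => [|[|]] //= _; ring.
Qed.

Lemma sum_agreement x : \sum_z agreement x z = 2 * N * q.+1%:R.
Proof.
under eq_bigr => z _ do rewrite agreement_sym agreementE.
rewrite exchange_big /=; under eq_bigr => i _ do rewrite word_single.
by rewrite sumr_const card_ord mulr_natr.
Qed.

(** Splits the double sum over coordinates into equal and distinct pairs. The predicate [Q] lets it
    serve for all vertices and for a single block. *)
Lemma agreement_square_expand (Q : pred word) x y :
  \sum_(z | Q z) agreement x z * agreement z y =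
  \sum_i ((letter x i == letter y i)%:R * \sum_(z | Q z) (letter z i == letter x i)%:R
    + \sum_(j | i != j) \sum_(z | Q z)
        (letter z i == letter x i)%:R * (letter z j == letter y j)%:R).
Proof.
under eq_bigr => z _ do rewrite !agreementE big_distrlr /=.
rewrite exchange_big; apply: eq_bigr => i _ /=; rewrite exchange_big /=.
rewrite (bigD1 i) //=; congr (_ + _).
  rewrite mulr_sumr; apply: eq_bigr => z _; rewrite -!natrM !mulnb.
  congr (nat_of_bool _)%:R; apply/andP/andP=> -[/eqP e /eqP e'].
    by rewrite e e' !eqxx.
  by rewrite -e e' !eqxx.
apply: eq_big => [j|j _]; first by rewrite eq_sym.
by apply: eq_bigr => z _; rewrite (eq_sym (letter x i)).
Qed.

Lemma card_other i : \sum_(j | i != j) 1 = q%:R :> F.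
Proof.
have : \sum_(j : 'I_q.+1) 1 = q.+1%:R :> F by rewrite sumr_const card_ord.
rewrite (bigD1 i) //= -natr1 addrC => /addIr <-.
by apply: eq_bigl => j; rewrite eq_sym.
Qed.

(** Each agreement contributes 2N, and each of the q(q+1) ordered pairs of distinct coordinates
    contributes 2. *)
Lemma agreement_square x y :
  \sum_z agreement x z * agreement z y
    = 2 * N * agreement x y + 2 * (q%:R * q.+1%:R).
Proof.
rewrite agreement_square_expand.
have E i : \sum_(j | i != j) \sum_z
    (letter z i == letter x i)%:R * (letter z j == letter y j)%:R = 2 * q%:R :> F.
  under eq_bigr => j ij do rewrite word_pair // -[2]mulr1.
  by rewrite -mulr_sumr card_other.
under eq_bigr => i _ do rewrite E word_single.
rewrite big_split /= -mulr_suml -agreementE sumr_const card_ord -mulr_natr.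
by ring.
Qed.

(** The twist restricts [z] to the block of [y]. Distinct coordinates contribute 2qD, where [D]
    counts the agreements of the blocks in [g]; the -1 in the twist removes exactly this, leaving
    the equal coordinates. *)
Lemma agreement_twist x y :
  \sum_z agreement x z * twist z y = 2 * q%:R * agreement x y.
Proof.
pose D := \sum_i (g y.1 i == g x.1 i)%:R : F.
have -> : \sum_z agreement x z * twist z y =
    \sum_(z | z.1 == y.1) agreement x z * agreement z y
    - \sum_(z | z.1 == y.1) agreement x z.
  rewrite -sumrB [RHS]big_mkcond; apply: eq_bigr => z _.
  by rewrite /twist; case: eqP => _ /=; ring.
have -> : \sum_(z | z.1 == y.1) agreement x z = 2 * q%:R * D.
  under eq_bigr => z _ do rewrite agreement_sym agreementE.
  rewrite exchange_big /=; under eq_bigr => i _ do rewrite block_single.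
  by rewrite -mulr_sumr.
rewrite agreement_square_expand.
have E i : \sum_(j | i != j) \sum_(z | z.1 == y.1)
    (letter z i == letter x i)%:R * (letter z j == letter y j)%:R
    = 2 * q%:R * (g y.1 i == g x.1 i)%:R :> F.
  under eq_bigr => j ij do rewrite block_pair // eqxx mulr1 -[X in 2 * X]mulr1.
  by rewrite -!mulr_sumr card_other; ring.
have E' i : (letter x i == letter y i)%:R *
      (\sum_(z | z.1 == y.1) (letter z i == letter x i)%:R)
    = 2 * q%:R * (letter x i == letter y i)%:R :> F.
  rewrite block_single; case: eqP => [e|_]; last by rewrite /=; ring.
  by rewrite -[(letter x i).1]/(g x.1 i) (congr1 fst e : g x.1 i = g y.1 i) eqxx /=; ring.
under eq_bigr => i _ do rewrite E E'.
by rewrite big_split /= -!mulr_sumr -agreementE -/D; ring.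
Qed.

(** Agreements within the block total 2q(q+1), and the block has 2q^2 vertices. *)
Lemma sum_twist x : \sum_z twist x z = 2 * q%:R.
Proof.
have -> : \sum_z twist x z =
    \sum_(z | z.1 == x.1) agreement z x - \sum_(z : word | z.1 == x.1) 1.
  rewrite -sumrB [RHS]big_mkcond; apply: eq_bigr => z _.
  by rewrite /twist agreement_sym eq_sym; case: eqP => _ /=; ring.
rewrite block_size.
under eq_bigr => z _ do rewrite agreementE.
rewrite exchange_big /=; under eq_bigr => i _ do rewrite block_single eqxx.
by rewrite sumr_const card_ord -[_ *+ q.+1]mulr_natr /= -natr1; ring.
Qed.

(** Within one block the first factor is an agreement minus 1, which reduces the sum to
    [agreement_twist] and [sum_twist]; across blocks all terms vanish. *)
Lemma twist_square x y : \sum_z twist x z * twist z y = 2 * q%:R * twist x y.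
Proof.
have [w|w] := eqVneq x.1 y.1; last first.
  rewrite [in RHS]/twist (negbTE w) mul0r mulr0 big1 // => z _; rewrite /twist.
  by case: (eqVneq x.1 z.1) => [<-|_]; rewrite ?(negbTE w) /=; ring.
transitivity (\sum_z (agreement x z * twist z y - twist z y)).
  apply: eq_bigr => z _; rewrite /twist -w (eq_sym z.1).
  by case: eqP => _ /=; ring.
rewrite sumrB agreement_twist.
under [X in _ - X]eq_bigr => z _ do rewrite twist_sym.
by rewrite sum_twist /twist w eqxx; rewrite /=; ring.
Qed.

End Counting.
End TwistedGraph.

(** * Graphs of diameter two *)

Section DiameterTwo.
Variable G : sgraph.
Implicit Types x y : G.

Lemma walk0E x y : walk 0 x y = (x == y).
Proof.
apply/existsP/idP=> [[p]|xy]; first by rewrite tuple0.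
by exists [tuple]; rewrite /= xy.
Qed.

Lemma walk1E x y : walk 1 x y = adj x y.
Proof.
apply/existsP/idP=> [[p]|xy].
  by case/tupleP: p => z p; rewrite tuple0 /= andbT => /andP[xz /eqP <-].
by exists [tuple y]; rewrite /= xy eqxx.
Qed.

Lemma walk2_common x y : (0 < common_nbrs x y)%N -> walk 2 x y.
Proof.
case/card_gt0P=> z; rewrite !inE => /andP[xz yz]; apply/existsP.
by exists [tuple z; y]; rewrite /= xz adj_sym yz eqxx.
Qed.

Lemma diameter_two :
  (exists x y, x != y /\ ~~ adj x y) ->
  (forall x y, x != y -> ~~ adj x y -> (0 < common_nbrs x y)%N) ->
  has_diameter G 2.
Proof.
move=> [x0 [y0 [xy0 nxy0]]] common.
have dist2 x y : x != y -> ~~ adj x y -> at_distance 2 x y.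
  move=> xy nxy; split; first by apply: walk2_common; apply: common.
  by case=> [|[|]] // _; rewrite ?walk0E ?walk1E.
split; last by exists x0, y0; apply: dist2.
move=> x y; have [->|xy] := eqVneq x y.
  by exists 0%N => //; split; rewrite ?walk0E.
have [axy|nxy] := boolP (adj x y); last by exists 2%N => //; apply: dist2.
exists 1%N => //; split; first by rewrite walk1E.
by case=> // _; rewrite walk0E.
Qed.
End DiameterTwo.

(** * Regularity, spectrum and edge counts of twisted graphs *)

Section TwistedGraphSpectrum.
Variables (q : nat) (T S W U : finType).
Variables (g : W -> 'I_q.+1 -> T) (f : U -> 'I_q.+1 -> S).
Variable sigma : W -> 'I_q.+1 -> {perm S}.
Hypotheses (q_gt0 : (0 < q)%N) (Sq : #|S| = q) (T_gt1 : (1 < #|T|)%N).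
Hypotheses (ga : orthogonal_array g) (fa : orthogonal_array f).
Variable F : numFieldType.

Let G : sgraph := twisted_graph g f sigma.
Let V : finType := word W U.
Let N : F := #|T|%:R * q%:R.
Let K := vertex_mx (agreement g f sigma F).
Let M := vertex_mx (twist g f sigma F).
Let J : 'M[F]_#|V| := const_mx 1.
Let A : 'M[F]_#|V| := adjmx F G.

(** These inequalities separate the eigenvalues and keep the graph from being complete. *)
Let Nq : N != 0 /\ (1 < N /\ q%:R < N).
Proof.
have q0 : 0 < q%:R :> F by rewrite ltr0n.
have q1 : 1 <= q%:R :> F by rewrite ler1n.
have T1 : 1 < #|T|%:R :> F by rewrite ltr1n.
have qN : q%:R < N by rewrite /N ltr_pMl.
by rewrite (le_lt_trans q1 qN) qN lt0r_neq0 // (lt_trans q0).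
Qed.

Let KK : K *m K = (2 * N) *: K + (2 * (q%:R * q.+1%:R)) *: J.
Proof.
rewrite /K mulmx_vertex; apply/matrixP=> i j.
by rewrite mxE (agreement_square sigma q_gt0 Sq ga fa) !mxE mulr1.
Qed.

Let KM : K *m M = (2 * q%:R) *: K.
Proof.
rewrite /K /M mulmx_vertex; apply/matrixP=> i j.
by rewrite mxE (agreement_twist g sigma q_gt0 Sq fa) !mxE.
Qed.

Let symK : K^T = K.
Proof. by apply/matrixP=> i j; rewrite !mxE agreement_sym. Qed.

Let symM : M^T = M.
Proof. by apply/matrixP=> i j; rewrite !mxE twist_sym. Qed.

Let MK : M *m K = (2 * q%:R) *: K.
Proof. by rewrite -{1}symM -{1}symK -trmx_mul KM linearZ /= symK. Qed.

Let MM : M *m M = (2 * q%:R) *: M.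
Proof.
rewrite /M mulmx_vertex; apply/matrixP=> i j.
by rewrite mxE (twist_square g sigma q_gt0 Sq fa) !mxE.
Qed.

Let mulmx_ones (h : V -> V -> F) a :
  (forall x, \sum_z h x z = a) -> vertex_mx h *m J = a *: J.
Proof.
move=> ha; apply/matrixP=> i j; rewrite !mxE mulr1 -(ha (enum_val i)).
rewrite [RHS]big_enum_val /=.
by apply: eq_bigr => k _; rewrite !mxE mulr1.
Qed.

Let KJ : K *m J = (2 * N * q.+1%:R) *: J.
Proof. by apply: mulmx_ones => x; rewrite (sum_agreement sigma q_gt0 Sq ga fa). Qed.

Let MJ : M *m J = (2 * q%:R) *: J.
Proof. by apply: mulmx_ones => x; rewrite (sum_twist g sigma q_gt0 Sq fa). Qed.

Let AE : A = K - 1%:M - M.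
Proof.
apply/matrixP=> i j; rewrite !mxE /adj /= (twisted_adjE f sigma ga).
by rewrite (inj_eq enum_val_inj).
Qed.

Let AK : A *m K = (2 * N - 1 - 2 * q%:R) *: K + (2 * (q%:R * q.+1%:R)) *: J.
Proof.
rewrite AE !mulmxBl mul1mx KK MK.
by apply/matrixP=> i j; rewrite !mxE; ring.
Qed.

Let AM : A *m M = (2 * q%:R) *: K - (1 + 2 * q%:R) *: M.
Proof.
rewrite AE !mulmxBl mul1mx KM MM.
by apply/matrixP=> i j; rewrite !mxE; ring.
Qed.

Let AJ : A *m J = (2 * N * q.+1%:R - 1 - 2 * q%:R) *: J.
Proof.
rewrite AE !mulmxBl mul1mx KJ MJ.
by apply/matrixP=> i j; rewrite !mxE; ring.
Qed.

(** The count is an entry of A^2, expanded as AK - A - AM. *)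
Lemma twisted_common_nbrs (x y : V) :
  (@common_nbrs G x y)%:R = (2 * N - 2 - 4 * q%:R) * agreement g f sigma F x y
    + 2 * (q%:R * q.+1%:R) + (x == y)%:R + (2 + 2 * q%:R) * twist g f sigma F x y
  :> F.
Proof.
rewrite -(@sqr_adjmx F G x y) -/A [X in _ *m X]AE !mulmxBr mulmx1 AK AM AE.
rewrite -(vertex_mxE (agreement g f sigma F)) -(vertex_mxE (twist g f sigma F)).
rewrite -/K -/M -(inj_eq (@enum_rank_inj V)).

move: (enum_rank x) (enum_rank y) (K) (M) => i j K0 M0.
by rewrite !mxE; ring.
Qed.

Lemma twisted_degree (x : V) :
  \sum_z (@adj G x z)%:R = 2 * N * q.+1%:R - 1 - 2 * q%:R :> F.
Proof.
under eq_bigr => z _ do rewrite /adj /= (twisted_adjE f sigma ga).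
rewrite !sumrB (sum_agreement sigma q_gt0 Sq ga fa) (sum_twist g sigma q_gt0 Sq fa).
by rewrite sum_indicator.
Qed.

Let vertex_exists : exists x : V, True.
Proof.
suff /card_gt0P[x _] : (0 < #|V|)%N by exists x.
have [N0 _] := Nq; rewrite lt0n -(eqr_nat F) (word_size sigma q_gt0 Sq ga fa).
by rewrite mulf_neq0 ?expf_neq0 // pnatr_eq0.
Qed.

(** A vertex adjacent to all others would have degree 2N^2 - 1, which amounts to (N - 1)(N - q) =
    0. *)
Lemma twisted_nonadjacent : exists x y : G, x != y /\ ~~ adj x y.
Proof.
have [x _] := vertex_exists; have [N0 [N1 qN]] := Nq.
suff /existsP[y /andP[xy nxy]] : [exists y : V, (x != y) && ~~ @adj G x y].
  by exists x, y.
apply: contraT; rewrite negb_exists => /forallP all_adj.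
have : \sum_z (@adj G x z)%:R + 1 = \sum_(z : V) 1 :> F.
  rewrite -[X in _ + X](sum_indicator F x) -big_split /=; apply: eq_bigr => z _.
  have := all_adj z; rewrite negb_and !negbK.
  have [->|_] /= := eqVneq x z; first by rewrite word_adj_irrefl add0r.
  by move=> ->; rewrite addr0.
rewrite twisted_degree sumr_const (word_size sigma q_gt0 Sq ga fa) -/N.
rewrite -[q.+1%:R]natr1 => e.
have : (N - 1) * (N - q%:R) = 0.
  apply: (mulfI (_ : 2 != 0)); first by rewrite pnatr_eq0.
  rewrite mulr0 -(subrr (2 * N ^+ 2)) -{2}e; ring.
by move/eqP; rewrite mulf_eq0 !subr_eq0 !gt_eqF.
Qed.

Lemma twisted_co_edge_regular : exists v k mu, co_edge_regular G v k mu.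
Proof.
have [x0 _] := vertex_exists.
exists #|G|, #|@nbrs G x0|, (2 * (q * q.+1))%N.
have common x y : x != y -> ~~ @adj G x y ->
    @common_nbrs G x y = (2 * (q * q.+1))%N.
  (* Non-adjacent vertices lie in different blocks with no agreement, so only the J term
     survives. *)
  move=> xy; rewrite /adj /= /word_adj xy /= negb_or -leqNgt leqn0.
  move=> /andP[w /eqP a0]; apply/eqP; rewrite -(eqr_nat F) twisted_common_nbrs.
  rewrite /twist /agreement a0 (negbTE w) (negbTE xy) !natrM /=; apply/eqP; ring.
split.
  split=> // [x|x y nxy [_ dist]].
    have deg z : #|@nbrs G z| = @common_nbrs G z z by rewrite /common_nbrs setIid.
    rewrite !deg; apply/eqP; rewrite -(eqr_nat F) !twisted_common_nbrs.
    by rewrite /twist /agreement !agree_refl !eqxx.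
  apply: common => //; apply: contraNneq (dist 0%N isT) => ->.
  by rewrite walk0E.
apply: diameter_two twisted_nonadjacent _ => x y xy nxy.
by rewrite common // !muln_gt0 q_gt0.
Qed.

Definition twisted_spectrum : seq F :=
  [:: - 2 * q%:R - 1; -1; 2 * N - 1 - 2 * q%:R;
      2 * N * q.+1%:R - 1 - 2 * q%:R].

(** Consecutive differences are 2q, 2(N - q) and 2Nq. The order yields both distinctness and the
    smallest eigenvalue. *)
Lemma twisted_spectrum_sorted : sorted <%R twisted_spectrum.
Proof.
have [N0 [N1 qN]] := Nq; have q0 : 0 < q%:R :> F by rewrite ltr0n.
rewrite /= andbT -[q.+1%:R]natr1; apply/and3P; split.
- by rewrite -subr_gt0 (_ : _ - _ = 2 * q%:R) ?mulr_gt0 ?ltr0n //; ring.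
- rewrite -subr_gt0 (_ : _ - _ = 2 * (N - q%:R)); last by ring.
  by rewrite mulr_gt0 ?subr_gt0 ?ltr0n.
- rewrite -subr_gt0 (_ : _ - _ = 2 * N * q%:R); last by ring.
  by rewrite mulr_gt0 // mulr_gt0 ?(lt_trans ltr01 N1) ?ltr0n.
Qed.

Lemma twisted_eigenvalue a : eigenvalue (adjmx F G) a = (a \in twisted_spectrum).
Proof.
have [N0 [N1 qN]] := Nq; have q0 : q%:R != 0 :> F by rewrite pnatr_eq0 -lt0n.
have [x _] := vertex_exists.
have N10 : N - 1 != 0 by rewrite subr_eq0 gt_eqF.
have Nq0 : N - q%:R != 0 by rewrite subr_eq0 gt_eqF.
have two0 : 2 != 0 :> F by rewrite pnatr_eq0.
(* [M / 2q] projects onto a space containing the image of K, which contains the constants. The four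
   summands of I in [s] project onto the successive complements and the constants; on each of them
   K, M and J act as scalars. *)
pose E := M - (q%:R / N) *: K + (q%:R ^+ 2 / N ^+ 2) *: J.
pose Z := K - (q.+1%:R / N) *: J.
pose s := [:: (- 2 * q%:R - 1, (2 * q%:R)^-1 *: E);
  (-1, 1%:M - (2 * q%:R)^-1 *: M);
  (2 * N - 1 - 2 * q%:R, (2 * N)^-1 *: Z);
  (2 * N * q.+1%:R - 1 - 2 * q%:R, (2 * N ^+ 2)^-1 *: J)].
(* Each summand is shown to be nonzero by its diagonal entry at [x]. *)
have ne0 (B : 'M[F]_#|V|) : B (enum_rank x) (enum_rank x) != 0 -> B != 0.
  by apply: contraNneq => ->; rewrite mxE.
have Kxx : K (enum_rank x) (enum_rank x) = q.+1%:R.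
  by rewrite vertex_mxE /agreement agree_refl.
have Mxx : M (enum_rank x) (enum_rank x) = q%:R.
  by rewrite vertex_mxE /twist /agreement agree_refl eqxx mul1r -[q.+1%:R]natr1 addrK.
have entries (a1 b c d : F) : (a1%:M + b *: K + c *: M + d *: J)
    (enum_rank x) (enum_rank x) = a1 + b * q.+1%:R + c * q%:R + d.
  rewrite [LHS]mxE [X in X + _]mxE [X in X + _ + _]mxE [X in _ + X + _]mxE Mxx.
  by rewrite [X in _ + X + _ + _]mxE Kxx !mxE eqxx mulr1n mulr1.
have symA : A^T = A by exact: (tr_adjmx F G).
rewrite (eigenvalue_of_decomposition symA (s := s)) //=.
- rewrite !big_cons big_nil addr0 /= /E /Z.
  apply/matrixP=> i j; move: (1%:M : 'M[F]_#|V|) (M) (K) (J) => I0 M0 K0 J0.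
  rewrite !mxE -[q.+1%:R]natr1; field.
  by rewrite N0 q0.
- move=> p; rewrite !inE => /or4P[] /eqP -> /=.
  + rewrite -scalemxAr /E mulmxDr mulmxBr -!scalemxAr AM AK AJ.
    move: (M) (K) (J) => M0 K0 J0; apply/matrixP=> i j; rewrite !mxE -[q.+1%:R]natr1.
    by field; rewrite N0 q0.
  + rewrite mulmxBr mulmx1 -scalemxAr AM AE.
    move: (1%:M : 'M[F]_#|V|) (M) (K) => I0 M0 K0; apply/matrixP=> i j.
    by rewrite !mxE; field.
  + rewrite -scalemxAr /Z mulmxBr -!scalemxAr AK AJ.
    move: (K) (J) => K0 J0; apply/matrixP=> i j; rewrite !mxE -[q.+1%:R]natr1.
    by field.
  + by rewrite -scalemxAr AJ scalerA mulrC -scalerA.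
- have E0 : E (enum_rank x) (enum_rank x) = q%:R * (N - 1) * (N - q%:R) / N ^+ 2.
    have -> : E = 0%:M + (- (q%:R / N)) *: K + 1 *: M + (q%:R ^+ 2 / N ^+ 2) *: J.
      by rewrite raddf0 add0r scale1r scaleNr [- _ + _]addrC.
    by rewrite entries -[q.+1%:R]natr1; field.
  have Z0 : Z (enum_rank x) (enum_rank x) = q.+1%:R * (N - 1) / N.
    have -> : Z = 0%:M + 1 *: K + 0 *: M + (- (q.+1%:R / N)) *: J.
      by rewrite raddf0 add0r scale1r scale0r addr0 scaleNr.
    by rewrite entries; field.
  move=> p; rewrite !inE => /or4P[] /eqP -> /=.
  + apply: ne0; rewrite mxE E0.
    move: (N) N0 N10 Nq0 => n n0 n10 nq0.
    rewrite !(mulf_eq0, invr_eq0, expf_eq0) /= !negb_or n0.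
    by rewrite ?n10 ?nq0 ?q0 ?two0 ?pnatr_eq0 ?oner_eq0.
  + apply: ne0; have -> : 1%:M - (2 * q%:R)^-1 *: M
        = 1%:M + 0 *: K + (- (2 * q%:R)^-1) *: M + 0 *: J.
      by rewrite !scale0r !addr0 scaleNr.
    rewrite entries (_ : _ + _ = 2^-1) ?invr_eq0 //.
    by field; rewrite q0.
  + apply: ne0; rewrite mxE Z0.
    move: (N) N0 N10 Nq0 => n n0 n10 nq0.
    rewrite !(mulf_eq0, invr_eq0, expf_eq0) /= !negb_or n0.
    by rewrite ?n10 ?nq0 ?q0 ?two0 ?pnatr_eq0 ?oner_eq0.
  + apply: ne0; rewrite !mxE mulr1.
    move: (N) N0 N10 Nq0 => n n0 n10 nq0.
    rewrite !(mulf_eq0, invr_eq0, expf_eq0) /= !negb_or n0.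
    by rewrite ?n10 ?nq0 ?q0 ?two0 ?pnatr_eq0 ?oner_eq0.
Qed.

Lemma twisted_num_eigenvalues : num_distinct_eigenvalues (adjmx F G) 4.
Proof.
exists twisted_spectrum; split=> //; last exact: twisted_eigenvalue.
exact: lt_sorted_uniq twisted_spectrum_sorted.
Qed.

Lemma twisted_smallest_eigenvalue : smallest_eigenvalue (adjmx F G) (- 2 * q%:R - 1).
Proof.
split; first by rewrite twisted_eigenvalue inE eqxx.
move=> b; rewrite twisted_eigenvalue => /predU1P[-> //|bs]; apply: ltW.
have := twisted_spectrum_sorted.
by move/(order_path_min lt_trans)/allP; apply.
Qed.

(** The two copies of [u0] in block [w] are adjacent and agree exactly where the permutation fixes
    the symbol of [u0]. Their count [l a] is injective in the number [a] of agreements, as N - q =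
    (#|T| - 1) q is positive. *)
Lemma twisted_edge_common_nbrs (u0 : U) :
  (forall a, (a < q + 2)%N ->
     exists w, #|[set i | f u0 i == sigma w i (f u0 i)]| = a) ->
  (q + 2 <= size (edge_common_nbrs G))%N.
Proof.
move=> agr; pose l a := (2 * (#|T| - 1) * q * a + 2 * (q * q - 1))%N.
have linj : injective l.
  move=> a b /addIn /eqP; rewrite eqn_pmul2l; first by move/eqP.
  by rewrite !muln_gt0 q_gt0 subn_gt0 T_gt1.
rewrite -(size_iota 0 (q + 2)) -(size_map l); apply: uniq_leq_size.
  by rewrite map_inj_uniq ?iota_uniq.
move=> c /mapP[a]; rewrite mem_iota add0n => /andP[_ /agr[w wa]] ->.
pose x : V := (w, (false, u0)); pose y : V := (w, (true, u0)).
have axy : agree g f sigma x y = a.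
  rewrite -wa; apply: eq_card => i; rewrite !inE /letter /= xpair_eqE eqxx /=.
  by rewrite perm1.
have xy : (x == y) = false by rewrite !xpair_eqE eqxx.
rewrite mem_undup; apply/mapP; exists (x, y).
  by rewrite mem_filter mem_enum /= /word_adj xy eqxx.
apply/eqP; rewrite -(eqr_nat F) twisted_common_nbrs.
rewrite /twist /agreement axy xy eqxx /l natrD !natrM !natrB ?muln_gt0 ?q_gt0 //.
  by rewrite /N -[q.+1%:R]natr1 natrM /=; apply/eqP; ring.
exact: ltnW.
Qed.

Lemma twisted_coherent_rank :
  (size (edge_common_nbrs G) + 2 <= \dim (coherent_closure (adjmx F G)))%N.
Proof.
have [cW AW _] := coherent_closureP (adjmx F G).
exact: (coherent_rank_lower_bound cW AW twisted_nonadjacent).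
Qed.

End TwistedGraphSpectrum.

(** * Choice of permutations and the infinite family *)

Lemma exists_agreeing_perms (m : nat) (S W : finType) (c : 'I_m -> S) :
  (1 < #|S|)%N ->
  exists sigma : W -> 'I_m -> {perm S},
    forall a, (a < #|W|)%N -> (a <= m)%N ->
      exists w, #|[set i | c i == sigma w i (c i)]| = a.
Proof.
move=> /card_gt1P[s0 [s1 [_ _ s01]]].
pose d s := if s == s0 then s1 else s0.
have dP s : d s != s by rewrite /d; case: (eqVneq s s0) => [->|]; rewrite eq_sym.
(* The block numbered [a] fixes the symbols at the first [a] coordinates and moves the others by a
   transposition. *)
exists (fun w (i : 'I_m) =>
  if (i < enum_rank w)%N then 1%g else tperm (c i) (d (c i))).
move=> a aW am; exists (enum_val (Ordinal aW)).
have winj : injective (widen_ord am).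
  by move=> x y /(congr1 (@nat_of_ord _)) xy; apply: val_inj.
rewrite -[RHS](card_ord a) -[RHS](card_imset _ winj).
apply: eq_card => i; rewrite inE enum_valK /=.
apply/idP/imsetP=> [|[j _ ->]]; last by rewrite /= ltn_ord perm1.
case: ltnP => [ia _|_]; first by exists (Ordinal ia) => //; apply: val_inj.
by rewrite tpermL eq_sym (negbTE (dP _)).
Qed.

Theorem theorem1p1 (R : realType) (q : nat) (hq : (2 <= q)%N)
  (hplane : (exists (P : finType) (L : {set {set P}}), affine_plane L q) \/
            (exists (P : finType) (L : {set {set P}}), projective_plane L q)) :
  infinitely_many (fun G : sgraph =>
    [/\ exists v k mu : nat, co_edge_regular G v k mu,
        num_distinct_eigenvalues (adjmx R[i] G) 4,
        smallest_eigenvalue (adjmx R[i] G) (- 2 * q%:R - 1),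
        (q + 2 <= size (edge_common_nbrs G))%N
      & (q + 4 <= coherent_rank R G)%N]).
Proof.
have [U [f fa]] : exists (U : finType) (f : U -> 'I_q.+1 -> 'I_q),
    orthogonal_array f.
  case: hplane => -[P [L plane]]; first exact: array_of_affine_plane hq plane.
  exact: array_of_projective_plane hq plane.
have q0 : (0 < q)%N by apply: ltnW.
have neq01 : ord0 != ord_max :> 'I_q.+1 by rewrite -val_eqE /= eq_sym -lt0n.
have [u0 _] : exists u0 : U, True.
  suff /card_gt0P[u _] : (0 < #|U|)%N by exists u.
  by rewrite (card_orthogonal_array neq01 fa) card_ord expn_gt0 q0.
pose good (G : sgraph) := [/\ exists v k mu : nat, co_edge_regular G v k mu,
  num_distinct_eigenvalues (adjmx R[i] G) 4,
  smallest_eigenvalue (adjmx R[i] G) (- 2 * q%:R - 1),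
  (q + 2 <= size (edge_common_nbrs G))%N & (q + 4 <= coherent_rank R G)%N].
(* The order grows strictly with [k], which makes the graphs pairwise non-isomorphic. *)
have graph k : exists G, good G /\ #|G| = (2 * q ^ 2 * (q ^ k.+1) ^ 2)%N.
  have [T [W [g [ga Tq]]]] := orthogonal_array_power k fa (card_ord q).
  have Wq : #|W| = ((q ^ k.+1) ^ 2)%N.
    by rewrite (card_orthogonal_array neq01 ga) Tq.
  (* There must be a block for each of the agreement values 0, ..., q+1; already q^2 >= q + 2 for q
     >= 2. *)
  have q2W : (q + 2 <= #|W|)%N.
    rewrite Wq; apply: (@leq_trans (q ^ 2)); first by nia.
    by rewrite leq_exp2r // -{1}(expn1 q) leq_exp2l.
  have T1 : (1 < #|T|)%N by rewrite Tq -{1}(exp1n k.+1) ltn_exp2r.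
  have Sq : #|'I_q| = q := card_ord q.
  have [|sigma sigmaP] := @exists_agreeing_perms q.+1 'I_q W (f u0).
    by rewrite card_ord.
  have agr a : (a < q + 2)%N ->
      exists w, #|[set i | f u0 i == sigma w i (f u0 i)]| = a.
    move=> aq; apply: sigmaP; first exact: leq_trans q2W.
    by rewrite -ltnS -addn2.
  have sizes := twisted_edge_common_nbrs q0 Sq T1 ga fa R[i] agr.
  exists (twisted_graph g f sigma); split; last first.
    rewrite !card_prod card_bool (card_orthogonal_array neq01 fa) Wq card_ord.
    by rewrite mulnC.
  split=> //.
  - exact: (twisted_co_edge_regular sigma q0 Sq T1 ga fa R[i]).
  - exact: (twisted_num_eigenvalues sigma q0 Sq T1 ga fa R[i]).
  - exact: (twisted_smallest_eigenvalue sigma q0 Sq T1 ga fa R[i]).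
  - apply: leq_trans (twisted_coherent_rank sigma q0 Sq T1 ga fa R[i]).
    by rewrite (_ : 4 = 2 + 2)%N // addnA leq_add2r.
have [G GP] := choice graph; exists G; split=> [k|k l kl [h [bh _]]].
  by have [] := GP k.
apply: kl; have := bij_eq_card bh; have [_ ->] := GP k; have [_ ->] := GP l.
move=> /eqP; rewrite eqn_pmul2l ?muln_gt0 ?expn_gt0 ?q0 //.
by rewrite eqn_exp2r // eqn_exp2l // eqSS => /eqP.
Qed.
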